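(* Assume that $k\ge 2$, $m\ge n\ge 2$ and $\mathcal{G}$ and $\mathcal{H}$ are arbitrary $k$-uniform hypergraphs. Then $$R(n\mathcal{G},m\mathcal{H})\le R((n-1)\mathcal{G},(m-1)\mathcal{H})+R(\mathcal{G},\mathcal{H})+1.$$ In particular, $$R(n\mathcal{G},m\mathcal{H})\le R(\mathcal{G},(m-n+1)\mathcal{H})+(n-1)(R(\mathcal{G},\mathcal{H})+1).$$
   Context: A $k$-uniform hypergraph $\mathcal{H}$ is a pair $(V,E)$ where $V$ is a set of vertices and $E$ is a set of $k$-subsets of $V$ (the edges). $n\mathcal{H}$ denotes $n$ disjoint copies of $\mathcal{H}$. For $k$-uniform $\mathcal{G},\mathcal{H}$, the Ramsey number $R(\mathcal{G},\mathcal{H})$ is the smallest positive integer $N$ such that every red-blue coloring of the edges of the complete $k$-uniform hypergraph on $N$ vertices contains a red copy of $\mathcal{G}$ or a blue copy of $\mathcal{H}$.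
   Formalization: It is assumed that G and H are not both without edges; otherwise the claim fails, e.g. k=2, n=2, m=6, G three isolated vertices, H one vertex: R(2G,6H)=6 but R(G,5H)+R(G,H)+1=5. *)

(* Defs.v *)
From mathcomp Require Import all_boot.

Set Implicit Arguments.
Unset Strict Implicit.
Unset Printing Implicit Defensive.

Record hypergraph (k : nat) := Hypergraph {
  vertex : finType;
  edges : {set {set vertex}};
  edges_uniform : forall e : {set vertex}, e \in edges -> #|e| = k
}.

Arguments Hypergraph {k}.
Arguments vertex {k} G : rename.
Arguments edges {k} G : rename.

Section Definitions.

Variable k : nat.
Implicit Types G H K : hypergraph k.

Definition copies_edges n G : {set {set 'I_n * vertex G}} :=
  [set [set (i, x) | x in e] | i : 'I_n, e : {set vertex G} in edges G].

Lemma copies_uniform n G (e : {set 'I_n * vertex G}) :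
  e \in copies_edges n G -> #|e| = k.
Proof.
case/imset2P=> i e0 _ e0G ->.
rewrite card_imset; first exact: edges_uniform e0G.
by move=> x y [].
Qed.

Definition copies n G : hypergraph k :=
  Hypergraph ('I_n * vertex G)%type (copies_edges n G) (@copies_uniform n G).

Definition complete_edges N : {set {set 'I_N}} := [set e : {set 'I_N} | #|e| == k].

Lemma complete_uniform N (e : {set 'I_N}) : e \in complete_edges N -> #|e| = k.
Proof. by rewrite inE => /eqP. Qed.

Definition complete N : hypergraph k :=
  Hypergraph 'I_N (complete_edges N) (@complete_uniform N).

(* The values of a coloring outside the edges of K are never used. *)
Definition coloring K := {ffun {set vertex K} -> bool}.

Definition red : bool := true.
Definition blue : bool := false.

Definition class_edges K (c : coloring K) (b : bool) : {set {set vertex K}} :=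
  [set e in edges K | c e == b].

Lemma class_uniform K (c : coloring K) b (e : {set vertex K}) :
  e \in class_edges c b -> #|e| = k.
Proof. by rewrite inE => /andP[/edges_uniform]. Qed.

Definition color_class K (c : coloring K) b : hypergraph k :=
  Hypergraph (vertex K) (class_edges c b) (@class_uniform K c b).

(* Copies are not required to be induced. *)
Definition contains K G : bool :=
  [exists f : {ffun vertex G -> vertex K},
    injectiveb f && [forall e : {set vertex G} in edges G, f @: e \in edges K]].

Definition arrows N G H : bool :=
  [forall c : coloring (complete N),
    contains (color_class c red) G || contains (color_class c blue) H].

End Definitions.

(* The finite Ramsey theorem, needed for Ramsey numbers to be well defined. *)
Lemma ramsey_sets k s t : exists N : nat,
  forall (T : finType) (c : {set T} -> bool) (X : {set T}), N <= #|X| ->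
  exists b, exists2 Y : {set T}, Y \subset X &
    #|Y| = (if b then s else t) /\
    (forall e : {set T}, e \subset Y -> #|e| = k -> c e = b).
Proof.
elim: k s t => [|k IHk] s t.
  exists (maxn s t) => T c X; rewrite geq_max => /andP[sX tX].
  exists (c set0).
  have /card_geqP[y [uy sy yX]] : (if c set0 then s else t) <= #|X|.
    by case: (c set0).
  exists [set x in y]; first by apply/subsetP => x; rewrite inE => /yX.
  split; first by rewrite cardsE -sy; apply/card_uniqP.
  by move=> e _ /cards0_eq ->.
have [u] := ubnP (s + t); elim: u s t => // u IHu [|s] [|t] ltu.
- exists 0 => T c X _; exists true, set0; rewrite ?sub0set ?cards0; split=> // e.
  by rewrite subset0 => /eqP->; rewrite cards0.
- exists 0 => T c X _; exists true, set0; rewrite ?sub0set ?cards0; split=> // e.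
  by rewrite subset0 => /eqP->; rewrite cards0.
- exists 0 => T c X _; exists false, set0; rewrite ?sub0set ?cards0; split=> // e.
  by rewrite subset0 => /eqP->; rewrite cards0.
have [|N1 H1] := IHu s t.+1; first by rewrite addSn in ltu.
have [|N2 H2] := IHu s.+1 t; first by rewrite addnS in ltu.
have [N0 H0] := IHk N1 N2.
exists N0.+1 => T c X leX.
have /card_gt0P[v vX] : 0 < #|X| by apply: leq_trans leX.
have leX' : N0 <= #|X :\ v| by move: leX; rewrite (cardsD1 v X) vX.
have [b [Y YX [cY mY]]] := H0 T (fun e => c (v |: e)) _ leX'.
have vY : v \notin Y by apply/negP => /(subsetP YX); rewrite !inE eqxx.
have YX' : Y \subset X := subset_trans YX (subsetDl _ _).
(* a b-monochromatic subset of Y extends by v *)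
have ext (Z : {set T}) : Z \subset Y ->
    (forall e : {set T}, e \subset Z -> #|e| = k.+1 -> c e = b) ->
    [/\ v |: Z \subset X, #|v |: Z| = #|Z|.+1 &
      forall e : {set T}, e \subset v |: Z -> #|e| = k.+1 -> c e = b].
  move=> ZY mZ; split.
  - by rewrite subUset sub1set vX (subset_trans ZY YX').
  - by rewrite cardsU1 (contra (subsetP ZY v) vY).
  move=> e eZ ce; have [ve|nve] := boolP (v \in e); last first.
    apply: mZ => //; apply/subsetP => x xe.
    have := subsetP eZ x xe; rewrite !inE => /orP[/eqP xv|//].
    by rewrite -xv xe in nve.
  rewrite -(setD1K ve); apply: mY.
    by apply: subset_trans ZY; rewrite subDset.
  by move: ce; rewrite (cardsD1 v) ve => -[].
case: b cY mY ext => cY mY ext.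
  have [b' [Z ZY [cZ mZ]]] := H1 T c Y (eq_leq (esym cY)).
  case: b' cZ mZ => cZ mZ.
    have [ZX cZ' mZ'] := ext Z ZY mZ.
    by exists true, (v |: Z) => //; rewrite cZ' cZ.
  by exists false, Z => //; apply: subset_trans YX'.
have [b' [Z ZY [cZ mZ]]] := H2 T c Y (eq_leq (esym cY)).
case: b' cZ mZ => cZ mZ.
  by exists true, Z => //; apply: subset_trans YX'.
have [ZX cZ' mZ'] := ext Z ZY mZ.
by exists false, (v |: Z) => //; rewrite cZ' cZ.
Qed.

Lemma contains_clique k (K G : hypergraph k) (Y : {set vertex K}) :
  #|Y| = #|vertex G| ->
  (forall e : {set vertex K}, e \subset Y -> #|e| = k -> e \in edges K) ->
  contains K G.
Proof.
move=> cY mY.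
pose f x : vertex K := enum_val (cast_ord (esym cY) (enum_rank x)).
have fI : injective f.
  by move=> x y /enum_val_inj/cast_ord_inj/enum_rank_inj.
have fE : finfun f =1 f by move=> x; rewrite ffunE.
apply/existsP; exists (finfun f); apply/andP; split.
  by apply/injectiveP => x y; rewrite !fE => /fI.
apply/forall_inP => e eG; rewrite (eq_imset _ fE); apply: mY.
  by apply/subsetP => _ /imsetP[x _ ->]; apply: enum_valP.
by rewrite card_imset //; apply: edges_uniform eG.
Qed.

Lemma ramsey_exists k (G H : hypergraph k) :
  exists N, (0 < N) && arrows N G H.
Proof.
have [N HN] := ramsey_sets k #|vertex G| #|vertex H|.
exists N.+1; rewrite /=; apply/forallP => c.
have [|b [Y _ [cY mY]]] := HN _ c setT; first by rewrite cardsT card_ord.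
have clique (e : {set 'I_N.+1}) : e \subset Y -> #|e| = k -> e \in edges (color_class c b).
  by move=> eY ce; rewrite !inE ce mY // !eqxx.
by case: b cY mY clique => cY _ cl; apply/orP; [left|right];
  exact: (@contains_clique _ (color_class c _) _ Y cY cl).
Qed.

Definition ramsey_number k (G H : hypergraph k) : nat :=
  ex_minn (ramsey_exists G H).

(* Main.v *)
(** A set of [R(G,H)+1] vertices containing both a red [G] and a blue [H] can
be removed: what is left contains a red [(n-1)G] or a blue [(m-1)H], which one
of the two removed copies completes. To find such a set, move from one
[R(G,H)]-set to another by exchanging one vertex at a time; if one contains a
red [G] and another a blue [H], then somewhere on the way two consecutive sets
do, and their union is as required. Otherwise all [R(G,H)]-sets contain, say, a
red [G], and [n] disjoint copies are picked greedily: there is room because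
[(n-1)|V(G)| <= R((n-1)G,(m-1)H)] as soon as [H] has an edge. *)
Require Import Defs.
From mathcomp Require Import all_boot zify.

Set Implicit Arguments.
Unset Strict Implicit.
Unset Printing Implicit Defensive.

(** A colouring is a predicate on all subsets of an arbitrary finite type, and the copy is confined
    to [X], so that the vertex set can be cut into pieces without relabelling. With [c] for red,
    blue is [predC c]. *)
Definition contains_in (T : finType) k (E : pred {set T}) (X : {set T})
    (G : hypergraph k) : bool :=
  [exists f : {ffun vertex G -> T},
    [&& injectiveb f, [forall x, f x \in X]
      & [forall e in edges G, E (f @: e)]]].

(** * Copies inside a vertex set *)

Section ContainsIn.

Variables (T : finType) (k : nat).
Implicit Types (E : pred {set T}) (X Y : {set T}) (G : hypergraph k).

Lemma contains_inP E X G :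
  reflect (exists f : vertex G -> T, [/\ injective f, forall x, f x \in X
             & forall e, e \in edges G -> E (f @: e)])
          (contains_in E X G).
Proof.
apply: (iffP existsP) => [[f /and3P[/injectiveP fI /forallP fX /forall_inP fE]]|].
  by exists f.
case=> f [fI fX fE]; exists (finfun f).
have ff : finfun f =1 f by move=> x; rewrite ffunE.
apply/and3P; split; first by apply/injectiveP => x y; rewrite !ff => /fI.
  by apply/forallP => x; rewrite ff.
by apply/forall_inP => e eG; rewrite (eq_imset _ ff); apply: fE.
Qed.

Lemma contains_inS E X Y G : X \subset Y -> contains_in E X G -> contains_in E Y G.
Proof.
move=> /subsetP XY /contains_inP[f [fI fX fE]].
by apply/contains_inP; exists f; split=> // x; apply: XY.
Qed.

Lemma eq_contains_in E1 E2 X G :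
  E1 =1 E2 -> contains_in E1 X G -> contains_in E2 X G.
Proof.
move=> eqE /contains_inP[f [fI fX fE]].
by apply/contains_inP; exists f; split=> // e eG; rewrite -eqE; apply: fE.
Qed.

Lemma contains_in_card E X G : contains_in E X G -> #|vertex G| <= #|X|.
Proof.
case/contains_inP=> f [fI fX _]; rewrite -(card_imset predT fI).
by apply/subset_leq_card/subsetP => _ /imsetP[x _ ->].
Qed.

(** Lets a copy be removed at the cost of its own vertices only. *)
Lemma contains_in_image E X G : contains_in E X G ->
  exists2 Y : {set T}, Y \subset X & #|Y| = #|vertex G| /\ contains_in E Y G.
Proof.
case/contains_inP=> f [fI fX fE]; exists (f @: predT).
  by apply/subsetP => _ /imsetP[x _ ->].
split; first exact: card_imset.
by apply/contains_inP; exists f; split=> // x; apply: imset_f.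
Qed.

Lemma contains_in_edgeless E X G :
  edges G = set0 -> #|vertex G| <= #|X| -> contains_in E X G.
Proof.
move=> G0 leX; apply/contains_inP.
exists (fun x => enum_val (widen_ord leX (enum_rank x))); split.
- move=> x y /enum_val_inj/(congr1 val)/= /val_inj; exact: enum_rank_inj.
- by move=> x; apply: enum_valP.
- by move=> e; rewrite G0 inE.
Qed.

Lemma contains_in_copies0 E X G : contains_in E X (copies 0 G).
Proof.
apply/contains_inP; have F (x : vertex (copies 0 G)) : False by case: x => [[]].
exists (fun x => False_rect T (F x)); split=> [x|x|e]; try by case: (F x).
by case/imset2P=> [[]].
Qed.

Lemma contains_in_copiesS p E X Y G : [disjoint X & Y] ->
  contains_in E X G -> contains_in E Y (copies p G) ->
  contains_in E (X :|: Y) (copies p.+1 G).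
Proof.
move=> dXY /contains_inP[f [fI fX fE]] /contains_inP[g [gI gY gE]].
have fg x y : f x <> g y.
  by move=> e; have := disjointFr dXY (fX x); rewrite e gY.
(* Index [ord0] is the new copy [f]; index [lift ord0 j] is the old copy [j] of [g]. *)
pose h (u : 'I_p.+1 * vertex G) :=
  if unlift ord0 u.1 is Some j then g (j, u.2) else f u.2.
have h0 x : h (ord0, x) = f x by rewrite /h /= unlift_none.
have hS j x : h (lift ord0 j, x) = g (j, x) by rewrite /h /= liftK.
apply/contains_inP; exists h; split.
- case=> [i x] [j y].
  case: (unliftP ord0 i) => [i'|] ->; case: (unliftP ord0 j) => [j'|] ->;
    rewrite ?h0 ?hS => e.
  + by case: (gI _ _ e) => -> ->.
  + by case: (fg y (i', x)).
  + by case: (fg x (j', y)).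
  + by rewrite (fI _ _ e).
- case=> i x; case: (unliftP ord0 i) => [i'|] ->; rewrite inE ?h0 ?hS.
    by rewrite gY orbT.
  by rewrite fX.
move=> _ /imset2P[i e _ eG ->]; rewrite -imset_comp.
case: (unliftP ord0 i) => [i'|] ->.
  rewrite (eq_imset (g := g \o pair i')) => [|x /=]; last by rewrite hS.
  by rewrite imset_comp; apply: gE; apply: imset2_f.
by rewrite (eq_imset (g := f)) => [|x /=]; [apply: fE | rewrite h0].
Qed.

(** * Greedy packing and vertex exchange *)

Lemma exists_subset_card X r : r <= #|X| ->
  exists2 Y : {set T}, Y \subset X & #|Y| = r.
Proof.
case/card_geqP=> s [us ss sX]; exists [set x in s].
  by apply/subsetP => x; rewrite inE => /sX.
by rewrite cardsE -ss; apply/card_uniqP.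
Qed.

(** Each copy is found in some [r]-subset and only its own vertices are removed; after [n] removals
    at least [r] vertices remain for the last copy. *)
Lemma contains_in_greedy E G r n X :
  (forall Y : {set T}, #|Y| = r -> contains_in E Y G) ->
  n * #|vertex G| + r <= #|X| -> contains_in E X (copies n.+1 G).
Proof.
move=> allr; elim: n X => [|n IHn] X leX.
all: have [|Z ZX cZ] := @exists_subset_card X r; first by lia.
all: have [Y YZ [cY EY]] := contains_in_image (allr Z cZ).
all: have YX := subset_trans YZ ZX.
all: have dY : [disjoint Y & X :\: Y] by rewrite disjoint_sym disjoints_subset setDE subsetIr.
all: rewrite -(setID X Y) (setIidPr YX); apply: contains_in_copiesS => //.
  exact: contains_in_copies0.
by apply: IHn; rewrite cardsD (setIidPr YX) cY; lia.
Qed.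

(* Discrete intermediate value theorem along vertex exchanges from [A] to [B]. *)
Lemma exchange_transition (P Q : {set T} -> Prop) (A B : {set T}) :
  (forall X, #|X| = #|A| -> P X \/ Q X) -> #|A| = #|B| -> P A -> Q B ->
  exists S X Y : {set T},
    [/\ X \subset S, Y \subset S, #|S| <= #|A|.+1, P X & Q Y].
Proof.
have [d] := ubnP #|A :\: B|; elim: d A => // d IHd A ltd PQ cAB PA QB.
have [AB|] := boolP (A \subset B).
  have eAB : A = B by apply/eqP; rewrite eqEcard AB cAB leqnn.
  by exists A, A, A; split=> //; rewrite eAB.
case/subsetPn=> x xA xB.
have /subsetPn[y yB yA] : ~~ (B \subset A).
  apply/negP => BA; have eBA : B = A by apply/eqP; rewrite eqEcard BA cAB leqnn.
  by rewrite eBA xA in xB.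
pose A' := y |: A :\ x.
have cA' : #|A'| = #|A|.
  by rewrite cardsU1 !inE (negPf yA) andbF (cardsD1 x A) xA.
(* If [Q A'], stop: [A] and [A'] both lie in [y |: A], one vertex larger than [A]. If [P A'], go on
   from [A'], which is one exchange closer to [B]. *)
have [PA'|QA'] := PQ _ cA'; last first.
  exists (y |: A), A, A'; split=> //; first exact: subsetUr.
    by rewrite setUS // subsetDl.
  by rewrite cardsU1 yA.
rewrite -cA'; apply: (IHd A') => //; rewrite ?cA' //.
have sub : A' :\: B \subset (A :\: B) :\ x.
  apply/subsetP => z; rewrite !inE => /andP[zB /orP[/eqP zy|/andP[-> ->]]].
    by rewrite zy yB in zB.
  by rewrite zB.
have := subset_leq_card sub.
by move: ltd; rewrite (cardsD1 x (A :\: B)) !inE xA xB; lia.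
Qed.

End ContainsIn.

(** * Ramsey numbers and arbitrary vertex sets *)

Section Ramsey.

Variable k : nat.
Implicit Types G H : hypergraph k.

Lemma color_class_contains N (c : coloring (complete k N)) b G :
  contains (color_class c b) G = contains_in (fun e => c e == b) setT G.
Proof.
apply/existsP/contains_inP => [[f /andP[/injectiveP fI /forall_inP fE]]|].
  exists f; split=> // e eG.
  by have := fE e eG; rewrite inE => /andP[].
case=> f [fI _ fE]; exists (finfun f).
have ff : finfun f =1 f by move=> x; rewrite ffunE.
apply/andP; split; first by apply/injectiveP => x y; rewrite !ff => /fI.
apply/forall_inP => e eG; rewrite (eq_imset _ ff) !inE fE // andbT.
by rewrite card_imset // (edges_uniform eG).
Qed.

Lemma arrows_contains_in N G H :
  arrows N G H <->
  forall c : pred {set 'I_N}, contains_in c setT G \/ contains_in (predC c) setT H.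
Proof.
split=> [/forallP ar c|ar].
  have := ar (finfun c); rewrite !color_class_contains => /orP[] h; [left|right];
    by apply: eq_contains_in h => e; rewrite ffunE /=; case: (c e).
apply/forallP => c; rewrite !color_class_contains.
case: (ar c) => h; apply/orP; [left|right];
  by apply: eq_contains_in h => e /=; case: (c e).
Qed.

Lemma arrows_ramsey_number G H : arrows (ramsey_number G H) G H.
Proof. by rewrite /ramsey_number; case: ex_minnP => N /andP[]. Qed.

Lemma ramsey_number_gt0 G H : 0 < ramsey_number G H.
Proof. by rewrite /ramsey_number; case: ex_minnP => N /andP[]. Qed.

Lemma ramsey_number_le N G H : 0 < N ->
  (forall c : pred {set 'I_N}, contains_in c setT G \/ contains_in (predC c) setT H) ->
  ramsey_number G H <= N.
Proof.
move=> N0 /arrows_contains_in ar; rewrite /ramsey_number.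
by case: ex_minnP => M _; apply; rewrite N0.
Qed.

Lemma ramsey_number_contains_in (T : finType) (c : pred {set T}) (X : {set T}) G H :
  ramsey_number G H <= #|X| -> contains_in c X G \/ contains_in (predC c) X H.
Proof.
(* The colouring is pulled back along an injection [g] of ['I_(ramsey_number G H)] into [X]. *)
move=> leX; pose g i : T := enum_val (widen_ord leX i).
have gI : injective g by move=> i j /enum_val_inj/(congr1 val)/= /val_inj.
have lift E K : contains_in (fun e => E (g @: e)) setT K -> @contains_in T k E X K.
  case/contains_inP=> f [fI _ fE]; apply/contains_inP; exists (g \o f); split.
  - exact: inj_comp.
  - by move=> x; apply: enum_valP.
  - move=> e eG; rewrite imset_comp; exact: (fE e eG).
have /arrows_contains_in := arrows_ramsey_number G H.
by move/(_ (fun e => c (g @: e))) => [] h; [left|right]; apply: lift.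
Qed.

Lemma ramsey_numberC G H : ramsey_number G H = ramsey_number H G.
Proof.
suff le G' H' : ramsey_number G' H' <= ramsey_number H' G'.
  by apply/eqP; rewrite eqn_leq !le.
apply: ramsey_number_le => [|c]; first exact: ramsey_number_gt0.
have [|h|h] := @ramsey_number_contains_in _ (predC c) setT H' G'.
- by rewrite cardsT card_ord.
- by right.
- by left; apply: eq_contains_in h => e /=; rewrite negbK.
Qed.

(** Colour everything red: a blue [H] is impossible since [H] has an edge, so [G] must fit. *)
Lemma card_vertex_le_ramsey_number G H :
  edges H != set0 -> #|vertex G| <= ramsey_number G H.
Proof.
case/set0Pn=> e eH; have [||/contains_inP[f [_ _ /(_ e eH)]] //] :=
  @ramsey_number_contains_in _ predT [set: 'I_(ramsey_number G H)] G H.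
- by rewrite cardsT card_ord.
- by move/contains_in_card; rewrite cardsT card_ord.
Qed.

(** * The recursive bound and its iteration *)

Lemma card_vertex_copies n G : #|vertex (copies n G)| = n * #|vertex G|.
Proof. by rewrite card_prod card_ord. Qed.

Lemma edges_copiesS n G : edges G != set0 -> edges (copies n.+1 G) != set0.
Proof.
case/set0Pn=> e eG; apply/set0Pn; exists [set (ord0, x) | x in e].
exact: imset2_f.
Qed.

(* [H] may be edgeless: then every [R(G,H)]-set trivially contains a [predC c]-copy of it. *)
Lemma ramsey_greedy (T : finType) (c : pred {set T}) G H n m :
  edges G != set0 \/ edges H != set0 ->
  (forall X : {set T}, #|X| = ramsey_number G H -> contains_in c X G) ->
  ramsey_number (copies n.+1 G) (copies m.+1 H) + ramsey_number G H <= #|T| ->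
  contains_in c setT (copies n.+2 G) \/ contains_in (predC c) setT (copies m.+2 H).
Proof.
move=> GH allG leT; have [H0|Hn] := eqVneq (edges H) set0; last first.
  left; apply: contains_in_greedy allG _; rewrite cardsT -card_vertex_copies.
  have := card_vertex_le_ramsey_number (copies n.+1 G) (edges_copiesS m Hn); lia.
have Gn : edges G != set0 by case: GH => //; rewrite H0 eqxx.
(* As [G] has an edge, [R(G,H)] vertices are enough to hold the edgeless [H], so copies of [H] are
   packed instead. *)
right; apply: (@contains_in_greedy _ _ _ _ (ramsey_number G H)) => [X cX|].
  by apply: contains_in_edgeless; rewrite // cX ramsey_numberC card_vertex_le_ramsey_number.
rewrite cardsT -card_vertex_copies.
have := card_vertex_le_ramsey_number (copies m.+1 H) (edges_copiesS n Gn).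
by rewrite ramsey_numberC; lia.
Qed.

(** The hypothesis on edges matters: if [G] and [H] are edgeless with 6 and 2 vertices, then
    [R(2G,6H) = 12], while [R(G,5H) + R(G,H) + 1 = 9]. *)
Lemma ramsey_number_copiesSS G H n m : edges G != set0 \/ edges H != set0 ->
  ramsey_number (copies n.+2 G) (copies m.+2 H)
    <= ramsey_number (copies n.+1 G) (copies m.+1 H) + ramsey_number G H + 1.
Proof.
move=> GH; set R1 := ramsey_number (copies n.+1 G) _; set r := ramsey_number G H.
apply: ramsey_number_le => [|c]; first by rewrite addn1.
set N := R1 + r + 1 in c *.
have rP (X : {set 'I_N}) : #|X| = r -> contains_in c X G \/ contains_in (predC c) X H.
  by move=> cX; apply: ramsey_number_contains_in; rewrite cX.
(* Either some [r]-set [B] has no red [G], hence a blue [H], or red copies of [G] can be packed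
   greedily. *)
have [/existsP[B /andP[/eqP cB nB]]|/existsPn allG] :=
    boolP [exists B : {set 'I_N}, (#|B| == r) && ~~ contains_in c B G]; last first.
  apply: ramsey_greedy => // [X cX|]; last by rewrite card_ord -/r; lia.
  by have := allG X; rewrite cX eqxx negbK.
have [/existsP[A /andP[/eqP cA nA]]|/existsPn allH] :=
    boolP [exists A : {set 'I_N}, (#|A| == r) && ~~ contains_in (predC c) A H]; last first.
  (* The same packing with the colours and the hypergraphs exchanged. *)
  have [|X cX||h|h] := @ramsey_greedy _ (predC c) H G m n.
  - by case: GH; [right|left].
  - by have := allH X; rewrite cX ramsey_numberC eqxx negbK.
  - by rewrite card_ord ramsey_numberC -/R1 (ramsey_numberC H) -/r; lia.
  - by right.
  - by left; apply: eq_contains_in h => e /=; rewrite negbK.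
have GA : contains_in c A G by case: (rP A cA) => // h; rewrite h in nA.
have HB : contains_in (predC c) B H by case: (rP B cB) => // h; rewrite h in nB.
have [||S [X [Y [XS YS cS GX HY]]]] := @exchange_transition _
    (fun X => contains_in c X G) (fun X => contains_in (predC c) X H) A B _ _ GA HB.
- by rewrite cA.
- by rewrite cA cB.
have GS := contains_inS XS GX; have HS := contains_inS YS HY.
have dS : [disjoint S & ~: S] by rewrite disjoints_subset setCK.
(* [S] takes at most [r + 1] of the [R1 + r + 1] vertices; the extra vertex of the exchange accounts
   for the final [+ 1]. *)
have cSC : R1 <= #|~: S|.
  by have := cardsC S; rewrite card_ord; move: cS; rewrite cA; lia.
by rewrite -(setUCr S); case: (ramsey_number_contains_in c cSC) => h; [left|right];
  apply: contains_in_copiesS.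
Qed.

Lemma ramsey_number_copies1 G H : ramsey_number (copies 1 G) H <= ramsey_number G H.
Proof.
apply: ramsey_number_le => [|c]; first exact: ramsey_number_gt0.
have [|h|h] := @ramsey_number_contains_in _ c setT G H.
- by rewrite cardsT card_ord.
- rewrite -[setT]setU0; left; apply: contains_in_copiesS h _; last first.
    exact: contains_in_copies0.
  by rewrite disjoint_sym disjoints_subset sub0set.
- by right.
Qed.

(** Each use of the recursion removes one copy on both sides, so the difference [d] stays fixed
    until a single copy of [G] is left. *)
Lemma ramsey_number_copies_iter G H n d : edges G != set0 \/ edges H != set0 ->
  ramsey_number (copies n.+1 G) (copies (n + d).+1 H)
    <= ramsey_number G (copies d.+1 H) + n * (ramsey_number G H + 1).
Proof.
move=> GH; elim: n => [|n IHn]; first by rewrite addn0 ramsey_number_copies1.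
by have := ramsey_number_copiesSS n (n + d) GH; rewrite addSn mulSn; lia.
Qed.

End Ramsey.

Theorem theorem3p2 (k m n : nat) (G H : hypergraph k)
    (k_ge2 : 2 <= k) (n_ge2 : 2 <= n) (n_le_m : n <= m)
    (not_both_edgeless : edges G != set0 \/ edges H != set0) :
  ramsey_number (copies n G) (copies m H)
    <= ramsey_number (copies (n - 1) G) (copies (m - 1) H)
       + ramsey_number G H + 1
  /\
  ramsey_number (copies n G) (copies m H)
    <= ramsey_number G (copies (m - n + 1) H)
       + (n - 1) * (ramsey_number G H + 1).
Proof.
case: n n_ge2 n_le_m => [|[|n]] // _ n_le_m; split.
  case: m n_le_m => [|[|m]] // _; rewrite !subn1.
  exact: ramsey_number_copiesSS.
(* Here [n.+2] is the original number of copies of [G], so [m - n.+2] is the fixed difference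
   [d]. *)
have -> : m = (n.+1 + (m - n.+2)).+1 by lia.
have -> : (n.+1 + (m - n.+2)).+1 - n.+2 + 1 = (m - n.+2).+1 by lia.
by rewrite subn1; apply: ramsey_number_copies_iter.
Qed.
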